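(* Let $A\in\mathrm{PSL}(2,\mathbb{Z})$. (i) Among all presentations $A=M(c_1,\ldots,c_k)$ (equality in $\mathrm{PSL}(2,\mathbb{Z})$, i.e. up to sign) with positive integers $c_1,\ldots,c_k$, the presentation with the smallest possible $k$ is unique. (ii) If $A$ is represented by the matrix $\begin{pmatrix}a&-b\\c&-d\end{pmatrix}$ with $a,b,c,d>0$ and $a>b$, then the coefficients $(c_1,\ldots,c_k)$ of this minimal presentation are those of the negative continued fraction $\frac{a}{c}=\llbracket c_1,\ldots,c_k\rrbracket$.
   Context: $M(c_1,\ldots,c_k)=\prod_{i=1}^{k}\begin{pmatrix}c_i&-1\\1&0\end{pmatrix}$ (product from left to right in increasing index). $\llbracket c_1,\ldots,c_k\rrbracket$ denotes the negative continued fraction $c_1-\cfrac{1}{c_2-\cfrac{1}{\ddots-\cfrac{1}{c_k}}}$. *)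

(* Defs.v *)
From HB Require Import structures.
From mathcomp Require Import all_boot all_order all_algebra.

Set Implicit Arguments.
Unset Strict Implicit.
Unset Printing Implicit Defensive.

Import Order.TTheory GRing.Theory Num.Theory.

Local Open Scope ring_scope.
Local Open Scope quotient_scope.

Definition mx2 (a b c d : int) : 'M[int]_2 :=
  \matrix_(i, j) (if i == 0 then (if j == 0 then a else b)
                            else (if j == 0 then c else d)).

Definition SL2Z : Type := {A : 'M[int]_2 | \det A == 1}.

Definition eq_up_to_sign (A B : SL2Z) : bool :=
  (val A == val B) || (val A == - val B).

Lemma eq_up_to_sign_equiv : equiv_class_of eq_up_to_sign.
Proof.
rewrite /eq_up_to_sign; split=> [A|A B|B A C]; first by rewrite eqxx.
  by rewrite [val A == _]eq_sym [val A == _]eq_sym eqr_oppLR.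
move=> /orP[] /eqP ->; rewrite // eqr_opp eqr_oppLR.
by rewrite orbC.
Qed.

Canonical eq_up_to_sign_equivRel := EquivRelPack eq_up_to_sign_equiv.

Definition PSL2Z : Type := {eq_quot eq_up_to_sign}.

Definition represented_by (A : PSL2Z) (m : 'M[int]_2) : Prop :=
  exists2 g : SL2Z, A = \pi_({eq_quot eq_up_to_sign}) g & val g = m.

Lemma represented_byE (g : SL2Z) (m : 'M[int]_2) :
  represented_by (\pi_({eq_quot eq_up_to_sign}) g) m <->
  m = val g \/ m = - val g.
Proof.
split=> [[h /eqmodP/= /orP[] /eqP e <-]|]; first by left.
  by right; rewrite e opprK.
case=> ->; first by exists g.
have dN : \det (- val g) == 1.
  by rewrite -scaleN1r detZ sqrrN expr1n mul1r; exact: valP g.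
exists (exist _ (- val g) dN : SL2Z) => //.
by apply/eqmodP/orP; right; rewrite /= opprK.
Qed.

Definition M (s : seq int) : 'M[int]_2 := \prod_(c <- s) mx2 c (-1) 1 0.

(* Presentations have length k >= 1; the empty product is excluded. *)
Definition presentation (A : PSL2Z) (s : seq int) : Prop :=
  [/\ s != [::], all (fun c => 0 < c) s & represented_by A (M s)].

Definition minimal_presentation (A : PSL2Z) (s : seq int) : Prop :=
  presentation A s /\
  forall t : seq int, presentation A t -> (size s <= size t)%N.

(* The value at [::] is a dummy. *)
Fixpoint ncf (s : seq int) : rat :=
  if s is c :: s' then
    if s' is [::] then c%:~R else c%:~R - (ncf s')^-1
  else 0.

(* Without the usual normalization c_2, ..., c_k >= 2 a rational number has
   many expansions, e.g. 1 = [[1]] = [[2, 1]].  The first coefficient is the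
   ceiling of x; for 0 < x <= 1 it equals 1. *)
Definition ncf_expansion (x : rat) (s : seq int) : Prop :=
  [/\ s != [::], all (fun c => 2 <= c) (behead s) & ncf s = x].

(* Main.v *)
(** Since [M(a,1,b) = M(a-1,b-1)] and [M(a,1,1,b) = - M(a+b-1)], a shortest
    presentation [(c_1, ..., c_k)] has no factor [(a,1,b)] with [a, b >= 2] and no
    factor [(a,1,1,b)]: its inner coefficients are at least 2, except possibly
    [c_2] when [c_1 = 1] and [c_(k-1)] when [c_k = 1].  For [k >= 3] this
    determines [c_1] from the image [v] of 0 under [M(c_1, ..., c_k)] on the
    projective line: either [c_1 - 1 <= v < c_1], or [v] is negative or infinite and
    [c_1 = 1].  As the tail of a shortest presentation is again shortest,
    uniqueness follows by induction; existence is Euclid's algorithm.  Under the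
    sign conditions of (ii) the exceptional ones at both ends are impossible, so
    the shortest presentation has [c_2, ..., c_k >= 2], and it is then the unique
    such expansion of the image [a/c] of infinity. *)
Require Import Defs.
From HB Require Import structures.
From mathcomp Require Import all_boot all_order all_algebra.
From mathcomp Require Import ring lra zify.
From Stdlib Require Classical_Prop.
Import Order.TTheory GRing.Theory Num.Theory.
Local Open Scope ring_scope.

(** * Entrywise calculus for integral 2 x 2 matrices and for [M] *)

Notation e00 X := ((X : 'M[int]_2) 0 0).
Notation e01 X := ((X : 'M[int]_2) 0 1).
Notation e10 X := ((X : 'M[int]_2) 1 0).
Notation e11 X := ((X : 'M[int]_2) 1 1).

Lemma mx2P (X Y : 'M[int]_2) :
  e00 X = e00 Y -> e01 X = e01 Y -> e10 X = e10 Y -> e11 X = e11 Y -> X = Y.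
Proof.
move=> h00 h01 h10 h11; apply/matrixP => i j.
have ordE (k : 'I_2) : k = 0 \/ k = 1.
  by case: k => [[|[|k]] hk]; [left | right | ]; try exact: val_inj.
by case: (ordE i) => ->; case: (ordE j) => ->.
Qed.

Lemma mx2E a b c d :
  (e00 (mx2 a b c d) = a) * (e01 (mx2 a b c d) = b) *
  (e10 (mx2 a b c d) = c) * (e11 (mx2 a b c d) = d).
Proof. by rewrite !mxE. Qed.

Lemma mulmx2E (X Y : 'M[int]_2) i j :
  (X * Y) i j = X i 0 * Y 0 j + X i 1 * Y 1 j.
Proof.
rewrite mxE !big_ord_recl big_ord0 addr0.
by congr (_ + X i _ * Y _ j); exact: val_inj.
Qed.

Lemma eta_mx2 (X : 'M[int]_2) : X = mx2 (e00 X) (e01 X) (e10 X) (e11 X).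
Proof. by apply: mx2P; rewrite mx2E. Qed.

Lemma mulmx2 a b c d a' b' c' d' :
  mx2 a b c d * mx2 a' b' c' d' =
  mx2 (a * a' + b * c') (a * b' + b * d') (c * a' + d * c') (c * b' + d * d').
Proof. by apply: mx2P; rewrite mulmx2E !mx2E. Qed.

Lemma oppmx2 a b c d : - mx2 a b c d = mx2 (- a) (- b) (- c) (- d).
Proof. by apply: mx2P; rewrite mxE !mx2E. Qed.

Lemma mx2_1 : 1 = mx2 1 0 0 1.
Proof. by apply: mx2P; rewrite mx2E mxE. Qed.

Lemma det_mx2E (X : 'M[int]_2) : \det X = e00 X * e11 X - e01 X * e10 X.
Proof.
rewrite (expand_det_row _ 0) !big_ord_recl big_ord0 /cofactor !det_mx11 !mxE /=.
rewrite expr0 expr1 mul1r addr0 mulN1r mulrN.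
congr (_ * X _ _ - X _ _ * X _ _); exact: val_inj.
Qed.

Lemma M_nil : M [::] = 1.
Proof. exact: big_nil. Qed.

Lemma M_cons c s : M (c :: s) = mx2 c (-1) 1 0 * M s.
Proof. exact: big_cons. Qed.

Lemma M_cat s t : M (s ++ t) = M s * M t.
Proof. exact: big_cat. Qed.

Lemma M_cons0 c s j : M (c :: s) 0 j = c * M s 0 j - M s 1 j.
Proof. by rewrite M_cons mulmx2E !mx2E mulN1r. Qed.

Lemma M_cons1 c s j : M (c :: s) 1 j = M s 0 j.
Proof. by rewrite M_cons mulmx2E !mx2E mul1r mul0r addr0. Qed.

Lemma M_seq1 c : M [:: c] = mx2 c (-1) 1 0.
Proof. by rewrite M_cons M_nil mulr1. Qed.

(** * Equality up to sign *)

Definition eqS (X Y : 'M[int]_2) : Prop := X = Y \/ X = - Y.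

Lemma eqS_refl X : eqS X X. Proof. by left. Qed.

Lemma eqS_sym {X Y} : eqS X Y -> eqS Y X.
Proof. by case=> ->; [left | right; rewrite opprK]. Qed.

Lemma eqS_trans {X Y Z} : eqS X Y -> eqS Y Z -> eqS X Z.
Proof.
by case=> ->; case=> ->; rewrite ?opprK; [left | right | right | left].
Qed.

Lemma eqS_mul {X X' Y Y'} : eqS X X' -> eqS Y Y' -> eqS (X * Y) (X' * Y').
Proof.
by case=> ->; case=> ->; rewrite ?mulrN ?mulNr ?opprK;
  [left | right | right | left].
Qed.

Lemma eqS_cons_inj {c s t} : eqS (M (c :: s)) (M (c :: t)) -> eqS (M s) (M t).
Proof.
(* The left factor is the inverse of [mx2 c (-1) 1 0]. *)
move=> /(eqS_mul (eqS_refl (mx2 0 1 (-1) c))).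
by rewrite !M_cons !mulrA mulmx2 !(mul0r, mulr1, mulr0, mul1r, mulN1r, add0r,
  addr0, addNr, opprK) -mx2_1 !mul1r.
Qed.

(** * Shortest sequences and their forbidden factors *)

Definition pos_seq (s : seq int) : bool :=
  (s != [::]) && all (fun c => 0 < c) s.

(* Shortest among the presentations of its own matrix, with no reference to a
   class in PSL(2, Z); this makes the notion stable under taking tails. *)
Definition min_seq (s : seq int) : Prop :=
  pos_seq s /\
  forall t : seq int, pos_seq t -> eqS (M t) (M s) -> (size s <= size t)%N.

Lemma min_seq_behead {c s} : min_seq (c :: s) -> s != [::] -> min_seq s.
Proof.
move=> [/andP[_ /= /andP[c0 sp]] smin] s0; split; first by rewrite /pos_seq s0.
move=> t /andP[_ tp] e; have := smin (c :: t); rewrite /pos_seq /= c0 tp ltnS.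
by apply=> //; rewrite !M_cons; apply: eqS_mul => //; exact: eqS_refl.
Qed.

Lemma min_seq_a1b {a b s} : min_seq (a :: 1 :: b :: s) -> a = 1 \/ b = 1.
Proof.
move=> [/andP[_ /= /and3P[a0 b0 sp]] smin].
have [->|a1] := eqVneq a 1; first by left.
have [->|b1] := eqVneq b 1; first by right.
have := smin (a - 1 :: b - 1 :: s); rewrite /pos_seq /= sp /=.
have -> : 0 < a - 1 by lia.
have -> : 0 < b - 1 by lia.
suff e : M (a - 1 :: b - 1 :: s) = M (a :: 1 :: b :: s).
  by rewrite e => /(_ isT (eqS_refl _)); rewrite ltnn.
by apply: mx2P; rewrite !(M_cons0, M_cons1); ring.
Qed.

Lemma min_seq_a11b {a b s} : ~ min_seq (a :: 1 :: 1 :: b :: s).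
Proof.
move=> [/andP[_ /= /and3P[a0 b0 sp]] smin].
have := smin (a + b - 1 :: s); rewrite /pos_seq /= sp /=.
have -> : 0 < a + b - 1 by lia.
suff e : M (a + b - 1 :: s) = - M (a :: 1 :: 1 :: b :: s).
  have h : eqS (M (a + b - 1 :: s)) (M (a :: 1 :: 1 :: b :: s)) by right.
  by move=> /(_ isT h); rewrite !ltnS; lia.
by apply: mx2P; rewrite mxE !(M_cons0, M_cons1); ring.
Qed.

Lemma min_seq_gt0 {c s} : min_seq (c :: s) -> 0 < c.
Proof. by case=> /andP[_ /= /andP[]]. Qed.

(** If [b = 1], then [a >= 2] forces [c = 1], and [d] completes the forbidden factor [(a,1,1,d)].
    Without [d] the sequence may end in [(a,1,1)]. *)
Lemma min_seq_ge2 {a b c d s} :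
  2 <= a -> min_seq (a :: b :: c :: d :: s) -> 2 <= b.
Proof.
move=> a2 m; have mb := min_seq_gt0 (min_seq_behead m isT).
have [b1|] := eqVneq b 1; last by lia.
rewrite {}b1 {mb} in m.
have [a1|c1] := min_seq_a1b m; first by rewrite a1 in a2.
by rewrite c1 in m; case: (min_seq_a11b m).
Qed.

(** * Sign invariants of the columns *)

(** For [p], [q] minus the second column, prepending [x] sends [(p, q)] to [(x p - q, p)], which
    preserves [0 <= q <= p] when [x >= 2]. Length two is a separate base case, as its first
    coefficient may be 1. *)
Lemma second_col_tail {c u} : 2 <= c -> min_seq (c :: u) -> u != [::] ->
  [/\ 0 < - e01 (M u), 0 <= - e11 (M u) & - e11 (M u) <= - e01 (M u)].
Proof.
elim: u c => // x [|y u] IH c c2 m _.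
  by rewrite M_seq1 !mx2E; split; lia.
have mx := min_seq_behead m isT.
have x0 := min_seq_gt0 mx.
case: u IH m mx => [|z u] IH m mx.
  by rewrite !(M_cons0, M_cons1) M_nil !mxE /=; split; lia.
have x2 := min_seq_ge2 c2 m.
have [p0 q0 pq] := IH x x2 mx isT.
rewrite (M_cons0 x) (M_cons1 x).
move: (e01 _) (e11 _) p0 q0 pq => p q *; split; nia.
Qed.

(* Write [D u], [E u] for minus the row sums of [M u]; then
   [D (c :: u) = c D u - E u] and [E (c :: u) = D u]: once a final 1 has made
   [D >= max 0 E], coefficients [c >= 2] preserve it. *)
Lemma not_ge2_tail {c u} : 2 <= c -> min_seq (c :: u) -> u != [::] ->
  all (fun x => 2 <= x) u \/
  (0 <= - e01 (M u) - e00 (M u) /\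
   - e11 (M u) - e10 (M u) <= - e01 (M u) - e00 (M u)).
Proof.
elim: u c => // x [|y u] IH c c2 m _.
  have x0 := min_seq_gt0 (min_seq_behead m isT).
  rewrite M_seq1 !mx2E /=.
  have [->|] := eqVneq x 1; first by right.
  by left; lia.
have mx := min_seq_behead m isT.
have my := min_seq_behead mx isT.
have x0 := min_seq_gt0 mx.
have y0 := min_seq_gt0 my.
case: u IH m mx my => [|z u] IH m mx my.
  have [->|y1] := eqVneq y 1.
    by right; rewrite !(M_cons0, M_cons1) M_nil !mxE /=; split; lia.
  have [x1|x1] := eqVneq x 1; last by left => /=; lia.
  by rewrite x1 in m; case: (min_seq_a1b m); lia.
have x2 := min_seq_ge2 c2 m.
have [al|[D0 DE]] := IH x x2 mx isT; first by left; move: al => /= ->; lia.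
right; rewrite 2!(M_cons0 x) 2!(M_cons1 x).
move: (e00 _) (e01 _) (e10 _) (e11 _) D0 DE => p q r s *; split; nia.
Qed.

(* The second alternative occurs exactly when [s] is nonempty and [c = x = 1]. *)
Lemma second_col_head {c x y s} : min_seq (c :: x :: y :: s) ->
  let p := - e01 (M (c :: x :: y :: s)) in
  let q := - e11 (M (c :: x :: y :: s)) in
  [/\ 0 < q, (c - 1) * q <= p & p < c * q] \/ [/\ p < 0, 0 <= q & c = 1].
Proof.
move=> m /=.
have mx := min_seq_behead m isT.
have my := min_seq_behead mx isT.
have c0 := min_seq_gt0 m.
have x0 := min_seq_gt0 mx.
have y0 := min_seq_gt0 my.
rewrite !(M_cons0 c) !(M_cons1 c) !(M_cons0 x) !(M_cons1 x).
have [x1|x1] := eqVneq x 1; last first.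
  have x2 : 2 <= x by lia.
  have [p0 q0 pq] := second_col_tail x2 mx isT.
  move: (e01 _) (e11 _) p0 q0 pq => p q *; left; split; nia.
(* For [(c,1,y)] the image of 0 is exactly [c - 1], so the lower bound cannot be strict. *)
case: s m mx my => [|z s] m mx my.
  rewrite !(M_cons0, M_cons1) M_nil !mxE /= x1; left; split; lia.
rewrite x1 in m mx *.
have [c1|c1] := eqVneq c 1; last first.
  have c2 : 2 <= c by lia.
  by have := min_seq_ge2 c2 m.
have y2 : 2 <= y.
  have [y1|] := eqVneq y 1; last by lia.
  by rewrite y1 in m; case: (min_seq_a11b m).
have [p0 q0 pq] := second_col_tail y2 my isT.
rewrite c1 !(M_cons0 y) !(M_cons1 y).
move: (e01 _) (e11 _) p0 q0 pq => p q *; right; split; nia.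
Qed.

(** * Uniqueness *)

Lemma eqS_entries {X Y} : eqS X Y ->
  [/\ e00 X = e00 Y, e01 X = e01 Y, e10 X = e10 Y & e11 X = e11 Y] \/
  [/\ e00 X = - e00 Y, e01 X = - e01 Y, e10 X = - e10 Y & e11 X = - e11 Y].
Proof. by case=> ->; [left | right]; rewrite ?mxE. Qed.

(** Up to length 2, [c] is an entry up to sign. From length 3 on, the intervals [[c - 1, c)]
    containing the image of 0 are disjoint and nonnegative, and a negative or infinite image means
    [c = 1]. *)
Lemma min_seq_head {c d u v} : min_seq (c :: u) -> min_seq (d :: v) ->
  size u = size v -> eqS (M (c :: u)) (M (d :: v)) -> c = d.
Proof.
move=> m n.
have c0 := min_seq_gt0 m.
have d0 := min_seq_gt0 n.
case: u v m n => [|x [|y u]] [|x' [|y' v]] // m n _ /eqS_entries.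
- rewrite !M_seq1 !mx2E; case=> [[? _ _ _]|[]]; lia.
- by rewrite !(M_cons0, M_cons1) M_nil !mxE /=; case=> [[_ ? _ _]|[]]; lia.
move=> E; have := second_col_head m; have := second_col_head n.
move: (e01 _) (e11 _) (e01 _) (e11 _) E => p q p' q' E H H'.
have {E} [[_ ? _ ?]|[_ ? _ ?]] := E; subst p' q' => {m n}.
all: by case: H => [[? ? ?]|[? ? ?]]; case: H' => [[? ? ?]|[? ? ?]]; nia.
Qed.

Lemma min_seq_uniq {s t} : min_seq s -> min_seq t -> eqS (M s) (M t) -> s = t.
Proof.
elim: s t => [|c u IH] [|d v] m n e; try by case: m => //; case: n.
have sz : size u = size v.
  apply/eqP; rewrite eqn_leq; apply/andP; split.
    exact: (m.2 (d :: v) n.1 (eqS_sym e)).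
  exact: (n.2 (c :: u) m.1 e).
have cd := min_seq_head m n sz e.
rewrite {}cd in m e *; congr cons.
have [u0|u0] := eqVneq u [::].
  by move: sz; rewrite u0; case: v {m n e}.
have v0 : v != [::] by rewrite -size_eq0 -sz size_eq0.
apply: IH; [exact: min_seq_behead m u0 | exact: min_seq_behead n v0 |
  exact: eqS_cons_inj e].
Qed.

(** * Existence *)

Lemma pos_seq_cat s t : pos_seq s -> pos_seq t -> pos_seq (s ++ t).
Proof.
case: s => // c s /andP[_ sp] /andP[_ tp].
by rewrite /pos_seq all_cat sp tp.
Qed.

Definition presentable (X : 'M[int]_2) : Prop :=
  exists2 s, pos_seq s & eqS (M s) X.

Lemma presentableM X Y : presentable X -> presentable Y -> presentable (X * Y).
Proof.
move=> [s sp es] [t tp et]; exists (s ++ t); first exact: pos_seq_cat.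
by rewrite M_cat; exact: eqS_mul.
Qed.

Lemma presentableN X : presentable X -> presentable (- X).
Proof.
move=> [s sp e]; exists s => //; apply: eqS_trans e _.
by right; rewrite opprK.
Qed.

(** [M [:: 1]] has order 6, so its cube is [-1]. *)
Lemma presentable1 : presentable 1.
Proof.
exists [:: 1; 1; 1] => //; right.
by rewrite mx2_1 oppmx2; apply: mx2P; rewrite !(M_cons0, M_cons1) M_nil !mxE.
Qed.

(** This is the matrix of the inadmissible coefficient 0; the witness is a positive word for its
    negative. *)
Lemma presentable_inv : presentable (mx2 0 (-1) 1 0).
Proof.
exists [:: 1; 1; 2; 1; 1] => //.
right; rewrite oppmx2.
by apply: mx2P; rewrite !(M_cons0, M_cons1) M_nil !mxE.
Qed.

Lemma presentable_transl (n : int) : presentable (mx2 1 n 0 1).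
Proof.
have transN (k : nat) (e : int) : presentable (mx2 1 e 0 1) ->
    presentable (mx2 1 (e * k%:Z) 0 1).
  move=> pe; elim: k => [|k IH].
    by rewrite mulr0 -mx2_1; exact: presentable1.
  have -> : mx2 1 (e * k.+1%:Z) 0 1 = mx2 1 e 0 1 * mx2 1 (e * k%:Z) 0 1.
    by rewrite mulmx2; congr mx2; rewrite -?[k.+1]add1n ?PoszD; ring.
  exact: presentableM.
case: (intP n) => [|k|k]; first by rewrite -mx2_1; exact: presentable1.
- rewrite -[k.+1%:Z]mul1r; apply: transN.
  (* This word and the one in the next case give minus the unit translations by 1 and -1. *)
  exists [:: 2; 1; 1] => //; right.
  by rewrite oppmx2; apply: mx2P; rewrite !(M_cons0, M_cons1) M_nil !mxE.
- rewrite -mulN1r; apply: transN.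
  exists [:: 1; 1; 2; 1] => //; right.
  by rewrite oppmx2; apply: mx2P; rewrite !(M_cons0, M_cons1) M_nil !mxE.
Qed.

Lemma presentable_SL2 (X : 'M[int]_2) : \det X = 1 -> presentable X.
Proof.
rewrite det_mx2E [X in presentable X]eta_mx2.
move: (e00 X) (e01 X) (e10 X) (e11 X) => a b c d {X}.
have [n] := ubnP `|c|%N; elim: n a b c d => // n IH a b c d lecn D.
have [c0|c0] := eqVneq c 0.
  subst c; rewrite mulr0 subr0 in D.
  have [[-> ->]|[-> ->]] : (a = 1 /\ d = 1) \/ (a = -1 /\ d = -1).
    have [a2|a2] : 2 <= a \/ a <= -2 \/ -1 <= a <= 1 by lia.
      by case: (lerP d 0) => d0; nia.
    case: a2 => a2; first by case: (lerP 0 d) => d0; nia.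
    have aE : a = 0 \/ a = 1 \/ a = -1 by lia.
    by case: aE D => [->|[->|->]]; lia.
    exact: presentable_transl.
  rewrite -[b]opprK -oppr0 -oppmx2; apply/presentableN/presentable_transl.
have eqa := divz_eq a c; have r0 := modz_ge0 a c0; have rc := ltz_mod a c0.
move: (a %/ c)%Z (a %% c)%Z eqa r0 rc => m r eqa r0 rc.
(* Euclidean step for [a = m * c + r]: the lower left entry of the last factor is [- r], smaller
   than [c] in absolute value. *)
have -> : mx2 a b c d =
    mx2 1 m 0 1 * (mx2 0 (-1) 1 0 * mx2 c d (- r) (m * d - b)).
  by rewrite !mulmx2 eqa; congr mx2; ring.
apply: presentableM; first exact: presentable_transl.
apply: presentableM; first exact: presentable_inv.
apply: IH; first by lia.
by rewrite -D eqa; ring.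
Qed.

Lemma min_seq_exists X : presentable X -> exists2 s, min_seq s & eqS (M s) X.
Proof.
move=> [s sp e]; have [n] := ubnP (size s).
elim: n s sp e => // n IH s sp e lesn.
have [[t [tp et lt]]|noshort] :=
    Classical_Prop.classic
      (exists t, [/\ pos_seq t, eqS (M t) (M s) & (size t < size s)%N]).
  by apply: (IH t) => //; [exact: eqS_trans e | exact: leq_trans lt _].
exists s => //; split=> // t tp et; rewrite leqNgt; apply/negP => lt.
by apply: noshort; exists t.
Qed.

(** * Negative continued fractions *)

Notation ge2_seq := (all (fun c : int => 2 <= c)).

Lemma ncf_cons c s : s != [::] -> ncf (c :: s) = c%:~R - (ncf s)^-1.
Proof. by case: s. Qed.

Lemma ncf_gt1 s : s != [::] -> ge2_seq s -> 1 < ncf s.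
Proof.
elim: s => // c s IH _ /andP[c2 s2].
have c2R : (2 : rat) <= c%:~R by rewrite (ler_int _ 2).
have [->|s0] := eqVneq s [::]; first by rewrite /=; lra.
have ncf1 := IH s0 s2.
rewrite ncf_cons //.
have : (ncf s)^-1 < 1 by rewrite invf_lt1 // (lt_trans ltr01).
lra.
Qed.

Lemma ncf_inj s t : s != [::] -> t != [::] ->
  ge2_seq (behead s) -> ge2_seq (behead t) -> ncf s = ncf t -> s = t.
Proof.
(* [f u] is what the tail subtracts from the first coefficient. It lies in [[0, 1)], which makes
   that coefficient the ceiling, and vanishes only for an empty tail. *)
pose f u : rat := if u is [::] then 0 else (ncf u)^-1.
have ncfE c u : ncf (c :: u) = c%:~R - f u by case: u => //=; rewrite subr0.
have f01 u : ge2_seq u -> 0 <= f u < 1.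
  case: u => [|c u] // u2; have := ncf_gt1 (c :: u) isT u2.
  rewrite /f => h; have h0 := lt_trans ltr01 h.
  by rewrite invr_ge0 (ltW h0) invf_lt1.
have f0 u : ge2_seq u -> u != [::] -> 0 < f u.
  case: u => [|c u] // u2 u0; have := ncf_gt1 (c :: u) isT u2.
  by rewrite /f => h; rewrite invr_gt0 (lt_trans ltr01).
elim: s t => // c s IH [|d t] // _ _; rewrite ![behead _]/= => s2 t2.
have /andP[fs0 fs1] := f01 _ s2; have /andP[ft0 ft1] := f01 _ t2.
rewrite !ncfE => e.
have cd : c = d.
  have h1 : (c%:~R : rat) < (d + 1)%:~R by rewrite intrD; lra.
  have h2 : (d%:~R : rat) < (c + 1)%:~R by rewrite intrD; lra.
  by rewrite !ltr_int in h1 h2; lia.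
rewrite {}cd in e *; congr cons.
have {}e : f s = f t by lra.
have [s0|s0] := eqVneq s [::]; have [t0|t0] := eqVneq t [::].
- by rewrite s0 t0.
- by have := f0 _ t2 t0; rewrite -e s0 ltxx.
- by have := f0 _ s2 s0; rewrite e t0 ltxx.
apply: IH => //.
- by case: s s2 {s0 e fs0 fs1} => //= x s /andP[].
- by case: t t2 {t0 e ft0 ft1} => //= x t /andP[].
move: e; rewrite /f; case: s s0 {s2 fs0 fs1} => // ? ? _.
by case: t t0 {t2 ft0 ft1} => // ? ? _; exact: invr_inj.
Qed.

Lemma first_col_ge2 s : s != [::] -> ge2_seq s -> 0 < e10 (M s) < e00 (M s).
Proof.
elim: s => // c s IH _ /andP[/= c2 s2].
have [->|s0] := eqVneq s [::]; first by rewrite M_seq1 !mx2E; lia.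
have := IH s0 s2; rewrite M_cons0 M_cons1.
move: (e00 _) (e10 _) => p r; nia.
Qed.

(** The first column is the image of infinity; [first_col_ge2] on the tail keeps the denominator
    nonzero. *)
Lemma ncf_first_col s : s != [::] -> ge2_seq (behead s) ->
  ncf s = (e00 (M s))%:~R / (e10 (M s))%:~R.
Proof.
elim: s => // c s IH _; rewrite [behead _]/= => s2.
have [->|s0] := eqVneq s [::]; first by rewrite M_seq1 !mx2E divr1.
have s2' : ge2_seq (behead s) by case: s s2 {IH s0} => //= x s /andP[].
have /andP[r0 rp] := first_col_ge2 _ s0 s2.
rewrite ncf_cons // IH // M_cons0 M_cons1 invf_div intrB intrM mulrBl mulfK //.
by rewrite intr_eq0; lia.
Qed.

(** * Excluding exceptional ones under the sign conditions of (ii) *)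

Lemma min_seq_tail_ge2 {s} {a b c d : int} : min_seq s ->
  0 < a -> 0 < b -> 0 < c -> 0 < d -> b < a -> b * c = a * d + 1 ->
  eqS (M s) (mx2 a (- b) c (- d)) -> ge2_seq (behead s).
Proof.
move=> m a0 b0 c0 d0 ba D.
(* The determinant relation makes the second row sum [c - d] positive. *)
have dc : d < c by nia.
case: s m => // c1 [|x [|y u]] // m /eqS_entries; rewrite !mx2E.
  rewrite !(M_cons0, M_cons1) M_nil !mxE /= => e.
  have := min_seq_gt0 m; have := min_seq_gt0 (min_seq_behead m isT).
  by case: e => [[? ? ? ?]|[? ? ? ?]] *; nia.
have mx := min_seq_behead m isT.
have my := min_seq_behead mx isT.
have c10 := min_seq_gt0 m.
have x0 := min_seq_gt0 mx.
move=> e.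
have [c2|c1E] : 2 <= c1 \/ c1 = 1 by lia.
  (* The negative entry [e01] of the tail fixes the sign; a final 1 would then give [c - d <= 0]. *)
  have [//|[D0 DE]] := not_ge2_tail c2 m isT.
  have [q0 _ _] := second_col_tail c2 m isT.
  move: e; rewrite !(M_cons1 c1) => e.
  by case: e => [[? ? ? ?]|[? ? ? ?]]; lia.
have [x2|x1] : 2 <= x \/ x = 1 by lia.
  have [ge2|[D0 DE]] := not_ge2_tail x2 mx isT; first by rewrite /= x2.
  have [q0 s0 qs] := second_col_tail x2 mx isT.
  move: e; rewrite !(M_cons1 c1) !(M_cons0 x).
  move: (e00 _) (e01 _) (e10 _) (e11 _) q0 s0 qs D0 DE.
  move=> p q r s q0 s0 qs D0 DE e.
  by case: e => [[_ _ ? ?]|[_ _ ? ?]]; nia.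
case: u m mx my e => [|z u] m mx my e.
  move: e; rewrite !(M_cons0, M_cons1) M_nil !mxE /= c1E x1.
  by case=> [[]|[]]; lia.
have y2 : 2 <= y.
  have [y1|] := eqVneq y 1; last by have := min_seq_gt0 my; lia.
  by rewrite c1E x1 y1 in m; case: (min_seq_a11b m).
(* Two leading ones make the image of 0 negative or infinite, whereas it is [b/d > 0]. *)
have [q0 s0 qs] := second_col_tail y2 my isT.
move: e; rewrite c1E x1 !(M_cons0 1, M_cons1 1) !(M_cons0 y) !(M_cons1 y).
move: (e00 _) (e01 _) (e10 _) (e11 _) q0 s0 qs => p q r s q0 s0 qs e.
by case: e => [[_ ? _ ?]|[_ ? _ ?]]; nia.
Qed.

(** * Passage to the quotient *)

Lemma presentationE (g : SL2Z) s :
  presentation (\pi_({eq_quot eq_up_to_sign})%qT g) s <->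
  pos_seq s /\ eqS (M s) (val g).
Proof.
rewrite /presentation /pos_seq; split.
  by case=> -> -> /represented_byE h.
by case=> /andP[s0 sp] h; split=> //; apply/represented_byE.
Qed.

Lemma minimal_presentationE (g : SL2Z) s :
  minimal_presentation (\pi_({eq_quot eq_up_to_sign})%qT g) s <->
  min_seq s /\ eqS (M s) (val g).
Proof.
split.
  case=> /presentationE[sp e] smin; split=> //; split=> // t tp et.
  by apply/smin/presentationE; split=> //; exact: eqS_trans et e.
case=> [[sp smin] e]; split; first exact/presentationE.
move=> t /presentationE[tp et]; apply: smin => //.
exact: eqS_trans et (eqS_sym e).
Qed.

Theorem theorem6p3 (A : PSL2Z) :
  (exists! s : seq int, minimal_presentation A s) /\
  (forall a b c d : int,
     0 < a -> 0 < b -> 0 < c -> 0 < d -> b < a ->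
     represented_by A (mx2 a (- b) c (- d)) ->
     forall s : seq int,
       minimal_presentation A s <-> ncf_expansion (a%:~R / c%:~R) s).
Proof.
rewrite -[A]reprK; set g := repr A.
have detg : \det (val g) = 1 by exact/eqP/(valP g).
have [t mt et] := min_seq_exists _ (presentable_SL2 _ detg).
split.
  exists t; split; first exact/minimal_presentationE.
  move=> s /minimal_presentationE[ms es].
  by apply: min_seq_uniq => //; exact: eqS_trans et (eqS_sym es).
move=> a b c d a0 b0 c0 d0 ba /represented_byE gE.
have D : b * c = a * d + 1.
  have : \det (mx2 a (- b) c (- d)) = 1.
    by case: gE => ->; rewrite // -scaleN1r detZ sqrrN expr1n mul1r.
  by rewrite det_mx2E !mx2E; lia.
have expansion s : min_seq s -> eqS (M s) (val g) ->
    ncf_expansion (a%:~R / c%:~R) s.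
  move=> ms es; have eX := eqS_trans es (eqS_sym gE).
  have s0 : s != [::] by case: ms => /andP[].
  have s2 := min_seq_tail_ge2 ms a0 b0 c0 d0 ba D eX.
  split=> //; rewrite ncf_first_col //.
  have [[-> _ -> _]|[-> _ -> _]] := eqS_entries eX; rewrite !mx2E //.
  by rewrite !rmorphN invrN mulrNN.
move=> s; split; first by move=> /minimal_presentationE[]; exact: expansion.
(* Conversely, uniqueness of expansions identifies [s] with the shortest presentation [t]. *)
move=> [s0 s2 sE]; have [t0 t2 tE] := expansion t mt et.
have -> : s = t by apply: ncf_inj => //; rewrite sE.
exact/minimal_presentationE.
Qed.
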